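(* Let $f:\mathbb R^n\to\mathbb R^p$ be a semi-weighted homogeneous (SWH) real polynomial map of weight-type $(w;\mathbf d)$. Then $f$ is IKND. If, in addition, $\Sigma(f_w)=\{0\}$, then $f$ is SIKND.
   Context: Notation. $[n]=\{1,\dots,n\}$. A real polynomial map $f=(f^1,\dots,f^p):\mathbb R^n\to\mathbb R^p$ has real polynomial components and $f(0)=0$. For a component $g=\sum c_\nu x^\nu$, $\mathrm{supp}(g)=\{\nu:c_\nu\ne0\}$; for $A\subset\mathbb R^n$, $g_A=\sum_{\nu\in A}c_\nu x^\nu$. For $w\in(\mathbb Q_{>0})^n$, $d(w;g)=\min\{\langle w,\nu\rangle:\nu\in\mathrm{supp}(g)\}$ ($+\infty$ if $g=0$) and $g_w$ is the sum of the terms attaining this minimum; $f_w=(f^1_w,\dots,f^p_w)$. $V(f)=f^{-1}(0)$; $\Sigma(f)$ is the set of points where the Jacobian matrix has rank $<p$. For $I\subset[n]$, $\mathbb R^I=\{x\in\mathbb R^n:x_i=0\ \forall i\notin I\}$ and $(\mathbb R^* )^I=\{x\in\mathbb R^I:x_i\ne0\ \forall i\in I\}$. SWH. A real polynomial map $f:\mathbb R^n\to\mathbb R^p$, $n\ge p$, is weighted homogeneous (WH) of weight-type $(w;\mathbf d)=(w_1,\dots,w_n;d_1,\dots,d_p)$, $w_i,d_j\in\mathbb Q_{>0}$, if $f^j(\lambda^{w_1}x_1,\dots,\lambda^{w_n}x_n)=\lambda^{d_j}f^j(x)$ for all $\lambda>0$ and all $j$. $f$ is SWH of weight-type $(w;\mathbf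 d)$ if $f_w$ is WH of weight-type $(w;\mathbf d)$, $\Sigma(f_w)\cap V(f_w)=\{0\}$, and $d(w;f^j-f^j_w)>d_j$ for each $j$. $C$-face diagrams. A $C$-face diagram is a set $D=D(J)=\{\nu\in(\mathbb R_{\ge0})^n:\min_{\ell\in J}\ell(\nu)=1\}$, with $J$ a nonempty finite set of linear forms with positive rational coefficients. For $w\in(\mathbb Q_{>0})^n$, $d(w;D)=\min_{\nu\in D}\langle w,\nu\rangle$, attained on $\Delta(w;D)$. $\mathcal P(D)\subset(\mathbb Q_{>0})^n$ consists of one weight vector $w$ for each $(n-1)$-dimensional face $\Delta(w;D)$ of $D$. A face of $D$ is a nonempty set $\Delta=\{\nu\in D:\nu_i=0\ (i\notin I_\Delta),\ \ell(\nu)=1\ (\ell\in J_\Delta)\}$ with $I_\Delta\subset[n]$, $\emptyset\ne J_\Delta\subset J$; it is inner if it is not contained in any proper coordinate subspace. For $C$-face diagrams $D_1,\dots,D_p$, $D=D_1+\dots+D_p$ denotes the union of the compact faces of the Minkowski sum of the polyhedra $D_j+(\mathbb R_{\ge0})^n$; it is again a $C$-face diagram, and each face $\Delta$ of $D$ decomposes uniquely as a Minkowski sum $\Delta=\Delta_1+\dots+\Delta_p$ with $\Delta_j$ a face of $D_j$. Put $f_\Delta=(f^1_{\Delta_1},\dots,f^p_{\Delta_p})$. IKND/SIKND. $f$ is IKND if there are $C$-face diagrams $D_1,\dots,D_p$ such that (a) $d(w;f^j)\ge d(w;D_j)$ for all $j$ and $w\in\mathcal P(D_j)$; and (b) for every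 inner face $\Delta$ of $D=D_1+\dots+D_p$ and every nonempty $I\subset[n]$ with $\Delta\cap\mathbb R^I\neq\emptyset$, $\Sigma(f_\Delta)\cap V(f_\Delta)\cap(\mathbb R^* )^I=\emptyset$. It is SIKND if moreover $\Sigma(f_\Delta)\cap(\mathbb R^* )^I=\emptyset$ for all such $\Delta,I$. *)

(* Defs.v *)
From mathcomp Require Import all_boot all_order all_algebra.
From mathcomp Require Import classical_sets boolp cardinality reals.
From mathcomp Require Import constructive_ereal topology normedtype exp.
From mathcomp Require mpoly.
(* The notations of mpoly are incompatible with those of exp, so polynomials
   are written with plain names: [mpoly n R] is {mpoly R[n]}, [meval x g] is
   g.@[x], [mderiv i g] is g^`M(i). *)
Import -(notations) mpoly.

Set Implicit Arguments.
Unset Strict Implicit.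
Unset Printing Implicit Defensive.

Import Order.TTheory GRing.Theory Num.Theory numFieldNormedType.Exports.
Local Open Scope classical_set_scope.
Local Open Scope ring_scope.

Section Euclidean.
Variables (R : realType) (n : nat).
Implicit Types (u v x y : 'rV[R]_n) (A B : set 'rV[R]_n) (I : {set 'I_n}).

Definition dot u v : R := \sum_(i < n) u 0 i * v 0 i.

(* A rational vector, used both as a weight and as the coefficients of a
   linear form on R^n. *)
Definition toR (w : 'rV[rat]_n) : 'rV[R]_n := map_mx ratr w.

Definition posw (w : 'rV[rat]_n) : Prop := forall i, 0 < w 0 i.

Definition orthant : set 'rV[R]_n := [set v | forall i, 0 <= v 0 i].

Definition coord_space I : set 'rV[R]_n :=
  [set x | forall i, i \notin I -> x 0 i = 0].

Definition coord_torus I : set 'rV[R]_n :=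
  coord_space I `&` [set x | forall i, i \in I -> x 0 i != 0].

Definition argmin u A : set 'rV[R]_n :=
  [set v | A v /\ forall v', A v' -> dot u v <= dot u v'].

(* The affine hull of A has dimension k: k differences of points of A form a
   basis of its direction. *)
Definition has_dim A (k : nat) : Prop :=
  exists (x0 : 'rV[R]_n) (M : 'M[R]_(k, n)),
    [/\ A x0, row_free M, (forall i, A (x0 + row i M))
      & forall x, A x -> (x - x0 <= M)%MS].

Definition mink_sum (p : nat) (A : 'I_p -> set 'rV[R]_n) : set 'rV[R]_n :=
  [set x | exists y : 'I_p -> 'rV[R]_n,
    (forall j, A j (y j)) /\ x = \sum_(j < p) y j].

(* Faces of a convex polyhedron; u = 0 gives the polyhedron itself. *)
Definition polyhedron_face A F : Prop :=
  F !=set0 /\ exists u, F = argmin u A.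

End Euclidean.

Section CFaceDiagrams.
Variables (R : realType) (n : nat).
Implicit Types (D F Delta : set 'rV[R]_n) (w : 'rV[rat]_n)
  (J : set 'rV[rat]_n).

Definition form_system J : Prop :=
  [/\ finite_set J, J !=set0 & forall l, J l -> posw l].

(* The two conditions on J say that min_(l in J) l(v) = 1. *)
Definition diagram J : set 'rV[R]_n :=
  [set v | [/\ orthant v, (forall l, J l -> 1 <= dot (toR R l) v)
             & exists2 l, J l & dot (toR R l) v = 1]].

Definition C_face_diagram D : Prop :=
  exists2 J, form_system J & D = diagram J.

(* d(w;D); the infimum is attained because a C-face diagram is closed. *)
Definition diagram_deg w D : R := inf [set dot (toR R w) v | v in D].

(* Faces of a C-face diagram D; J0 and I0 are J_Delta and I_Delta. The set of
   faces of D does not depend on the system J of forms representing D. *)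
Definition diagram_face D Delta : Prop :=
  exists J, [/\ form_system J, D = diagram J &
    exists (J0 : set 'rV[rat]_n) (I0 : {set 'I_n}),
      [/\ J0 `<=` J, J0 !=set0, Delta !=set0
        & Delta = [set v | [/\ D v, coord_space I0 v
                             & forall l, J0 l -> dot (toR R l) v = 1]]]].

Definition inner Delta : Prop :=
  forall I : {set 'I_n}, I != [set: 'I_n]%SET ->
    ~ (Delta `<=` coord_space I).

(* P(D) is determined up to rescaling each of its vectors; P is one such
   choice. *)
Definition facet_weights D (P : set 'rV[rat]_n) : Prop :=
  [/\ forall w, P w -> posw w,
      forall w, P w -> has_dim (argmin (toR R w) D) n.-1
    & forall F, diagram_face D F -> has_dim F n.-1 ->
        exists! w, P w /\ argmin (toR R w) D = F].

(* D_1 + ... + D_p *)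
Definition diagram_sum (p : nat) (D : 'I_p -> set 'rV[R]_n) : set 'rV[R]_n :=
  let Q := mink_sum (fun j => [set x + y | x in D j & y in @orthant R n]) in
  \bigcup_(F in [set F | polyhedron_face Q F /\ compact F]) F.

End CFaceDiagrams.

Section PolynomialMaps.
Variables (R : realType) (n p : nat).
Implicit Types (g : mpoly n R) (f : 'I_p -> mpoly n R).
Implicit Types (w : 'rV[rat]_n) (d : 'rV[rat]_p).

Definition expt (m : multinom n) : 'rV[R]_n := \row_i (m i)%:R.

Definition part g (A : set 'rV[R]_n) : mpoly n R :=
  \sum_(m <- msupp g | `[< A (expt m) >]) mcoeff m g *: mpolyX R m.

Definition wdeg w g : \bar R :=
  (\big[Order.min/+oo]_(m <- msupp g) (dot (toR R w) (expt m))%:E)%E.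

Definition initial w g : mpoly n R :=
  part g [set v | (dot (toR R w) v)%:E = wdeg w g].

Definition initial_map w f : 'I_p -> mpoly n R := fun j => initial w (f j).

Definition polynomial_map f : Prop := forall j, meval (fun=> 0) (f j) = 0.

Definition zeros f : set 'rV[R]_n := [set x | forall j, meval (x 0) (f j) = 0].

Definition jacobian f (x : 'rV[R]_n) : 'M[R]_(p, n) :=
  \matrix_(j < p, i < n) meval (x 0) (mderiv i (f j)).

Definition crit f : set 'rV[R]_n := [set x | (\rank (jacobian f x) < p)%N].

Definition WH w d f : Prop :=
  [/\ (p <= n)%N, posw w, posw d &
    forall (lambda : R) (x : 'rV[R]_n) (j : 'I_p), 0 < lambda ->
      meval (fun i => lambda `^ ratr (w 0 i) * x 0 i) (f j)
      = lambda `^ ratr (d 0 j) * meval (x 0) (f j)].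

Definition SWH w d f : Prop :=
  [/\ WH w d (initial_map w f),
      crit (initial_map w f) `&` zeros (initial_map w f) = [set 0]
    & forall j, ((ratr (d 0 j))%:E < wdeg w (f j - initial w (f j))%R)%E].

Definition diagrams_below f (D : 'I_p -> set 'rV[R]_n) : Prop :=
  (forall j, C_face_diagram (D j)) /\
  exists P : 'I_p -> set 'rV[rat]_n, forall j,
    facet_weights (D j) (P j) /\
    forall w, P j w -> ((diagram_deg w (D j))%:E <= wdeg w (f j))%E.

(* [Z f_Delta] misses (R^* )^I for every inner face Delta of the sum and every
   nonempty I with Delta meeting R^I. The decomposition Deltas of Delta into
   faces of the D j exists and is unique, so f_Delta is well defined. *)
Definition face_condition (Z : ('I_p -> mpoly n R) -> set 'rV[R]_n) f
    (D : 'I_p -> set 'rV[R]_n) : Prop :=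
  forall (Delta : set 'rV[R]_n) (Deltas : 'I_p -> set 'rV[R]_n),
    diagram_face (diagram_sum D) Delta -> inner Delta ->
    (forall j, diagram_face (D j) (Deltas j)) -> Delta = mink_sum Deltas ->
    forall I : {set 'I_n}, I != finset.set0 ->
      Delta `&` coord_space I !=set0 ->
      Z (fun j => part (f j) (Deltas j)) `&` coord_torus I = set0.

Definition IKND f : Prop :=
  exists D : 'I_p -> set 'rV[R]_n, diagrams_below f D /\
    face_condition (fun h => crit h `&` zeros h) f D.

Definition SIKND f : Prop :=
  exists D : 'I_p -> set 'rV[R]_n, [/\ diagrams_below f D,
    face_condition (fun h => crit h `&` zeros h) f D
    & face_condition crit f D].

End PolynomialMaps.

(* Main.v *)
Require Import Defs.
From mathcomp Require Import all_boot all_order all_algebra.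
From mathcomp Require Import classical_sets boolp cardinality reals.
From mathcomp Require Import constructive_ereal topology normedtype exp.
From mathcomp Require mpoly.
Import -(notations) mpoly.
Import Order.TTheory GRing.Theory Num.Theory numFieldNormedType.Exports.
Local Open Scope classical_set_scope.
Local Open Scope ring_scope.

(** Every nonzero component [f j] has weighted degree [d j], and the natural
    diagrams to try are those with a single facet: the simplices [w . v = d j]
    in the orthant, each given by the one form [w / d j]. The theorem is true
    because such a simplex has exactly one inner face, itself, so that the
    conditions on all inner faces shrink to one condition, which is the
    hypothesis on [f_w].

    Diagrams below [f]: the initial form of a nonzero [f j] consists of
    monomials of one weight [e], so it satisfies the homogeneity equation with
    [e] as well as with [d j]. Comparing both at a point where it does not
    vanish gives [e = d j] ([WH_wdeg]); such a point exists since a nonzero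
    polynomial over an infinite domain has a nonzero value
    ([mpoly_neq0_eval]). The only facet of the simplex is the simplex itself
    ([simplex_facet_weights]), so the weights to test reduce to [w].

    Inner faces: a form that is at least 1 on the simplex [w . v = c] dominates
    [w / c] coefficientwise, so where it equals 1 every coordinate at which the
    domination is strict vanishes; hence a face is the whole simplex or lies in
    a coordinate hyperplane ([simplex_face]). The sum of the simplices of
    levels [c j] is the simplex of level [\sum_j c j]
    ([diagram_sum_simplex]), and its decomposition as a sum of faces can only
    be the one into full simplices, as seen at the vertices
    ([simplex_face_summand]). Therefore [f_Delta] is [f_w] at every inner face
    [Delta]. If a set of singularities of [f_w] is contained in the origin, it
    misses every torus of a nonempty set of coordinates
    ([WH_face_condition]); taking critical zeros, resp. all critical points,
    gives the two assertions. *)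

(** * Nonzero values of nonzero polynomials *)

Lemma digits_inj (n N : nat) (a b : 'I_n -> nat) :
  (forall i, (a i < N)%N) -> (forall i, (b i < N)%N) ->
  (\sum_(i < n) a i * N ^ i = \sum_(i < n) b i * N ^ i)%N -> a =1 b.
Proof.
elim: n a b => [|n IH] a b a_lt b_lt; first by move=> _ [].
have shift (c : 'I_n.+1 -> nat) : (\sum_(i < n.+1) c i * N ^ i
    = (\sum_(i < n) c (lift ord0 i) * N ^ i) * N + c ord0)%N.
  rewrite big_ord_recl /= expn0 muln1 addnC big_distrl /=; congr (_ + _)%N.
  by apply: eq_bigr => i _; rewrite /bump /= add1n expnSr mulnA.
rewrite !shift => eq_ab.
have eq0 : a ord0 = b ord0.
  move: (congr1 (modn^~ N) eq_ab).
  by rewrite !modnMDl !modn_small.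
move: eq_ab; rewrite eq0 => /addIn /eqP.
rewrite eqn_pmul2r ?(leq_ltn_trans _ (a_lt ord0)) // => /eqP.
move=> /(IH _ _ (fun=> a_lt _) (fun=> b_lt _)) eq_lift i.
by case: (unliftP ord0 i) => [j|] -> //; exact: eq_lift.
Qed.

Lemma poly_nonroot (R : numDomainType) (q : {poly R}) :
  q != 0 -> exists t, q.[t] != 0.
Proof.
move=> q0; apply/not_existsP => allroot.
have := @max_poly_roots _ q [seq i%:R | i <- iota 0 (size q)] q0.
rewrite size_map size_iota ltnn => H; suff: false by []; apply: H.
  apply/allP => t _; apply/rootP/eqP; apply: contrapT => /negP; exact: allroot.
by rewrite map_inj_uniq ?iota_uniq // => i j /eqP; rewrite eqr_nat => /eqP.
Qed.

(** Kronecker substitution [x_i = t ^ (N ^ i)]: for [N] larger than all the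
    exponents, distinct monomials become distinct powers of [t], because the
    base [N] digits of the power are the exponents, so a univariate polynomial
    with the same coefficients is left. *)
Lemma mpoly_neq0_eval {R : numDomainType} {n : nat} {g : mpoly n R} :
  g <> 0 -> exists x : 'rV[R]_n, meval (x 0) g != 0.
Proof.
move=> /eqP g0.
pose N := (\max_(m <- msupp g) (mdeg m).+1)%N.
have N_gt m i : m \in msupp g -> (m i < N)%N.
  move=> mg; rewrite /N (big_rem m) //= (leq_trans _ (leq_maxl _ _)) // ltnS.
  by rewrite mdegE (bigD1 i) //= leq_addr.
pose k (m : multinom n) := (\sum_(i < n) m i * N ^ i)%N.
have k_inj : {in msupp g &, injective k}.
  move=> m m' mg m'g /digits_inj kk; apply/mnmP => i.
  by apply: kk => j; apply: N_gt.
pose q : {poly R} := \sum_(m <- msupp g) mcoeff m g *: 'X^(k m).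
have q0 : q != 0.
  have mg : mlead g \in msupp g by rewrite mlead_supp.
  apply/eqP => /(congr1 (coefp (k (mlead g)))) /=; rewrite coef0 coef_sum.
  rewrite (big_rem _ mg) /= coefZ coefXn eqxx mulr1 big_seq big1 ?addr0.
    by move/eqP; rewrite mleadc_eq0 (negPf g0).
  move=> m; rewrite mem_rem_uniq ?msupp_uniq // => /andP[/= neq m_g].
  rewrite coefZ coefXn; case: eqVneq => [/k_inj e|]; last by rewrite mulr0.
  by rewrite e ?eqxx // in neq.
have [t tP] := poly_nonroot _ _ q0.
exists (\row_i t ^+ (N ^ i)%N).
suff -> : meval ((\row_i t ^+ (N ^ i)%N) 0) g = q.[t] by [].
rewrite mevalE horner_sum; apply: eq_bigr => m _.
rewrite hornerZ hornerXn /k; congr (_ * _).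
rewrite expr_sum; apply: eq_bigr => i _.
by rewrite mxE -exprM mulnC.
Qed.

(** * Initial forms and weighted degree *)

Section Degree.
Context {R : realType} {n : nat}.
Implicit Types (u v x : 'rV[R]_n) (w : 'rV[rat]_n) (g : mpoly n R).

Lemma mcoeff_part m g A :
  mcoeff m (part g A) = if `[< A (expt R m) >] then mcoeff m g else 0.
Proof.
rewrite /part raddf_sum /=.
under eq_bigr do rewrite mcoeffZ mcoeffX.
have [mg|mg] := boolP (m \in msupp g); last first.
  rewrite big_seq_cond big1 ?(memN_msupp_eq0 mg) ?if_same //.
  move=> m' /andP[m'g _]; case: eqVneq => [e|]; last by rewrite mulr0.
  by rewrite -e m'g in mg.
rewrite big_mkcond (big_rem _ mg) /= eqxx mulr1 big_seq big1 ?addr0 //.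
move=> m'; rewrite mem_rem_uniq ?msupp_uniq // => /andP[/= neq _].
by rewrite (negPf neq) mulr0 if_same.
Qed.

Lemma eq_part g A B :
  (forall m, m \in msupp g -> A (expt R m) <-> B (expt R m)) ->
  part g A = part g B.
Proof.
move=> AB; apply/mpolyP => m; rewrite !mcoeff_part.
have [mg|/memN_msupp_eq0 ->] := boolP (m \in msupp g); last by rewrite !if_same.
by rewrite (asbool_equiv_eq (AB m mg)).
Qed.

Lemma wdeg_attained w g : g <> 0 ->
  exists2 m, m \in msupp g & wdeg w g = (dot (toR R w) (expt R m))%:E.
Proof.
move=> /eqP; rewrite -msupp_eq0 /wdeg.
elim: (msupp g) => // m s IH _; rewrite big_cons.
have [->|/IH[m' m's ->]] := eqVneq s [::].
  by exists m; rewrite ?mem_head // big_nil min_l ?leey.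
rewrite /Order.min; case: ifP => _; first by exists m; rewrite ?mem_head.
by exists m' => //; rewrite in_cons m's orbT.
Qed.

Lemma mevalX_weighted w (lambda : R) x (m : multinom n) : 0 < lambda ->
  meval (fun i => lambda `^ ratr (w 0 i) * x 0 i) (mpolyX R m)
  = lambda `^ dot (toR R w) (expt R m) * meval (x 0) (mpolyX R m).
Proof.
move=> l0; rewrite !mevalX.
have powR_sum : {morph (fun r => lambda `^ r) : r s / r + s >-> r * s}.
  by move=> r s; rewrite powRD // (gt_eqF l0) implybT.
rewrite /dot (big_morph _ powR_sum (powRr0 _)) -big_split /=.
apply: eq_bigr => i _; rewrite !mxE exprMn powRrM powR_mulrn //.
exact: powR_ge0.
Qed.

Lemma initial_weighted w (lambda e : R) x g :
  0 < lambda -> wdeg w g = e%:E ->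
  meval (fun i => lambda `^ ratr (w 0 i) * x 0 i) (initial w g)
  = lambda `^ e * meval (x 0) (initial w g).
Proof.
move=> l0 we; rewrite /initial /part !raddf_sum /= mulr_sumr.
apply: eq_bigr => m /asboolP /=; rewrite we => -[me].
by rewrite !mevalZ mevalX_weighted // me mulrCA.
Qed.

(** The initial form is homogeneous of its own degree and, by assumption, of
    degree [d j]; a nonzero value cancels from the two equations. The case
    [f j = 0] has to be excluded: there the degree is infinite. *)
Lemma WH_wdeg {p : nat} {f : 'I_p -> mpoly n R} {w} {d : 'rV[rat]_p}
    (j : 'I_p) :
  WH w d (initial_map w f) -> f j <> 0 -> wdeg w (f j) = (ratr (d 0 j))%:E.
Proof.
move=> [_ _ _ hom] f0; have [m mf we] := wdeg_attained w _ f0.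
have in0 : initial w (f j) <> 0.
  move/(congr1 (mcoeff m)); rewrite mcoeff_part mcoeff0 we.
  case: asboolP => [_ e|/(_ erefl)//].
  by have := mcoeff_eq0 (f j) m; rewrite e eqxx mf.
have [x x0] := mpoly_neq0_eval in0.
(* Any positive base other than 1 determines the exponent of its powers. *)
have := hom 2 x j (ltr0n _ 2).
rewrite /initial_map (initial_weighted _ _ _ _ _ (ltr0n _ 2) we).
move=> /(mulIf x0) /(congr1 (@ln R)); rewrite !ln_powR.
move=> /mulIf e; rewrite we; congr (_%:E); apply: e.
by rewrite gt_eqF // ln_gt0 // ltr1n.
Qed.

End Degree.

(** * The simplex cut out of the orthant by a positive linear form *)

Section Simplex.
Context {R : realType} {n : nat}.
Implicit Types (u v x : 'rV[R]_n) (c : R).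

Lemma dotDr u x y : dot u (x + y) = dot u x + dot u y.
Proof.
by rewrite /dot -big_split; apply: eq_bigr => i _; rewrite mxE mulrDr.
Qed.

Lemma dotZr u a x : dot u (a *: x) = a * dot u x.
Proof.
by rewrite /dot mulr_sumr; apply: eq_bigr => i _; rewrite mxE mulrCA.
Qed.

Lemma dotZl u a x : dot (a *: u) x = a * dot u x.
Proof.
by rewrite /dot mulr_sumr; apply: eq_bigr => i _; rewrite mxE mulrA.
Qed.

Lemma dot_sumr u (p : nat) (y : 'I_p -> 'rV[R]_n) :
  dot u (\sum_j y j) = \sum_j dot u (y j).
Proof.
rewrite /dot exchange_big; apply: eq_bigr => i _.
by rewrite summxE mulr_sumr.
Qed.

Lemma dot_delta u i : dot u (delta_mx 0 i) = u 0 i.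
Proof.
rewrite /dot (bigD1 i) //= big1 ?addr0; first by rewrite mxE !eqxx mulr1.
by move=> k /negPf ki; rewrite mxE ki mulr0.
Qed.

Lemma dot_ge0 u v : (forall i, 0 <= u 0 i) -> orthant v -> 0 <= dot u v.
Proof. by move=> u0 v0; apply: sumr_ge0 => i _; rewrite mulr_ge0. Qed.

Lemma dot_mulmx u x : dot u x = (x *m u^T) 0 0.
Proof. by rewrite mxE; apply: eq_bigr => i _; rewrite mxE mulrC. Qed.

Definition simplex u c : set 'rV[R]_n := [set v | orthant v /\ dot u v = c].

Definition vertex u c i : 'rV[R]_n := (c / u 0 i) *: delta_mx 0 i.

Lemma simplex_vertex u c i : 0 < u 0 i -> 0 <= c -> simplex u c (vertex u c i).
Proof.
move=> u0 c0; split.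
  move=> k; rewrite !mxE /= mulr_ge0 ?ler0n // divr_ge0 // ltW //.
by rewrite dotZr dot_delta divfK // gt_eqF.
Qed.

Lemma argmin_simplex u (c : R) : argmin u (simplex u c) = simplex u c.
Proof.
apply/seteqP; split=> v; first by case.
by move=> Sv; split=> // v' [_ ->]; rewrite Sv.2.
Qed.

Lemma simplex_diagram (l : 'rV[rat]_n) (c : rat) : 0 < c ->
  diagram [set c^-1 *: l] = simplex (toR R l) (ratr c).
Proof.
move=> c0; have c0' : (ratr c : R) != 0 by rewrite fmorph_eq0 gt_eqF.
have dotE v : dot (toR R (c^-1 *: l)) v = dot (toR R l) v / ratr c.
  by rewrite /toR map_mxZ fmorphV dotZl mulrC.
apply/seteqP; split=> v.
  move=> [v0 _ [_ ->]]; rewrite dotE => /(congr1 (fun r => r * ratr c)).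
  by rewrite divfK // mul1r.
move=> [v0 vc]; have e : dot (toR R (c^-1 *: l)) v = 1.
  by rewrite dotE vc divff.
by split=> // [_ ->|]; [rewrite e | exists (c^-1 *: l)].
Qed.

Lemma diagram_face_sub (D Delta : set 'rV[R]_n) :
  diagram_face D Delta -> Delta `<=` D.
Proof. by move=> [J [_ _ [J0 [I0 [_ _ _ ->]]]]] v []. Qed.

(** Each form [l] of a system representing the simplex satisfies
    [u / c <= l] coefficientwise, by evaluation at the vertices. If the face
    lies in no coordinate hyperplane, a strict inequality at [i] is impossible:
    [l] and [u / c] both equal 1 on the face, which would force [v i = 0] there.
    Hence the conditions defining the face already hold on the simplex. *)
Lemma simplex_face u c Delta : (forall i, 0 < u 0 i) -> 0 < c ->
  diagram_face (simplex u c) Delta ->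
  Delta = simplex u c \/ exists i, forall v, Delta v -> v 0 i = 0.
Proof.
move=> u0 c0 [J [_ DJ [J0 [I0 [J0J _ _ ->]]]]].
have [no_i|] := pselect (exists i, forall v, [/\ simplex u c v,
  coord_space I0 v & forall l, J0 l -> dot (toR R l) v = 1] -> v 0 i = 0).
  by right.
move=> /forallNP no_i; left.
have I0T i : i \in I0.
  by apply: contra_notT (no_i i) => iI v [_ vI _]; apply: vI.
have l_ge l i : J0 l -> u 0 i / c <= toR R l 0 i.
  move=> /J0J Jl; have := simplex_vertex u c i (u0 i) (ltW c0).
  rewrite DJ => -[_ /(_ l Jl)]; rewrite dotZr dot_delta => le1 _.
  by rewrite ler_pdivrMr // -[u 0 i]mul1r -ler_pdivlMr // -mulrA mulrC.
have l_eq l i : J0 l -> toR R l 0 i = u 0 i / c.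
  move=> Jl; apply/eqP; rewrite eq_le l_ge // andbT leNgt.
  apply: contra_notN (no_i i) => lt_i v [[v0 vc] _ /(_ l Jl) lv].
  have : \sum_k (toR R l 0 k - u 0 k / c) * v 0 k = 0.
    under eq_bigr do rewrite mulrBl.
    rewrite sumrB -/(dot _ _) lv.
    under [X in _ - X]eq_bigr do rewrite mulrAC.
    by rewrite -mulr_suml -/(dot _ _) vc divff ?subrr // gt_eqF.
  move=> /eqP; rewrite psumr_eq0; last first.
    by move=> k _; rewrite mulr_ge0 ?subr_ge0 ?l_ge.
  move=> /allP /(_ i (mem_index_enum _)) /=; rewrite mulf_eq0 subr_eq0.
  by rewrite gt_eqF //= => /eqP.
apply/seteqP; split=> v [] // v0 vc; split=> //.
  by move=> i; rewrite I0T.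
move=> l Jl; rewrite /dot (eq_bigr (fun i => u 0 i * v 0 i / c)).
  by rewrite -mulr_suml -/(dot _ _) vc divff // gt_eqF.
by move=> i _; rewrite l_eq // mulrAC.
Qed.

Lemma simplex_inner_face u c Delta : (forall i, 0 < u 0 i) -> 0 < c ->
  diagram_face (simplex u c) Delta -> inner Delta -> Delta = simplex u c.
Proof.
move=> u0 c0 DD innerD.
case: (simplex_face _ _ _ u0 c0 DD) => // -[i Di]; exfalso.
apply: (innerD (~: [set i])%SET) => [|v /Di vi k].
  by apply/eqP => /setP /(_ i); rewrite !inE eqxx.
by rewrite !inE negbK => /eqP ->.
Qed.

End Simplex.

(** * The dimension of the simplex and of its faces *)

Section SimplexDimension.
Context {R : realType} {n : nat}.
Implicit Types (u v x : 'rV[R]_n) (c : R).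

(** The edges issued from the vertex on the first axis form a basis of the
    direction of the simplex. *)
Lemma simplex_has_dim u c : (0 < n)%N -> (forall i, 0 < u 0 i) -> 0 < c ->
  has_dim (simplex u c) n.-1.
Proof.
case: n u => // k u _ u0 c0 /=.
have cu i : c / u 0 i != 0 by rewrite mulf_neq0 ?invr_eq0 ?gt_eqF.
pose M := \matrix_i (vertex u c (lift ord0 i) - vertex u c ord0).
have Mlift (a : 'rV_k) j :
    (a *m M) 0 (lift ord0 j) = a 0 j * (c / u 0 (lift ord0 j)).
  rewrite mxE (bigD1 j) //= big1 ?addr0 => [|i ij]; rewrite !mxE !eqxx /=.
    by rewrite mulr1 mulr0 subr0.
  by rewrite (inj_eq lift_inj) eq_sym (negPf ij) !mulr0 subr0 mulr0.
exists (vertex u c ord0), M; split.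
- by apply: simplex_vertex => //; rewrite ltW.
- apply: inj_row_free => a /matrixP aM; apply/rowP => j.
  have /eqP := aM 0 (lift ord0 j).
  by rewrite Mlift !mxE mulf_eq0 (negPf (cu _)) orbF => /eqP.
- move=> i; rewrite rowK addrC subrK.
  by apply: simplex_vertex => //; rewrite ltW.
- move=> x [x0 xc]; apply/submxP.
  exists (\row_j (x 0 (lift ord0 j) * u 0 (lift ord0 j) / c)).
  apply/rowP => i; case: (unliftP ord0 i) => [j|] ->.
    rewrite Mlift !mxE /= mulr0 subr0 mulrA divfK ?gt_eqF // mulfK //.
    by rewrite gt_eqF.
  move: xc; rewrite /dot big_ord_recl => xc.
  rewrite !mxE eqxx mulr1 /=.
  under eq_bigr do
    rewrite !mxE /= mulr0 mulr1 sub0r mulrN mulrA divfK ?gt_eqF //.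
  rewrite sumrN -mulr_suml; under eq_bigr do rewrite mulrC.
  apply: (mulIf (x := u 0 ord0)); first by rewrite gt_eqF.
  rewrite mulrBl mulNr !divfK ?gt_eqF //.
  by apply/eqP; rewrite -xc opprD mulrC addrA subrr sub0r.
Qed.

(** A point of [F] has level [c != 0] while the differences in [F] have level 0,
    so adding that point to the [n.-1] independent differences yields a basis
    of the whole space, which no coordinate function can kill. *)
Lemma simplex_facet_coord u c i F : c != 0 -> F `<=` simplex u c ->
  has_dim F n.-1 -> ~ forall v, F v -> v 0 i = 0.
Proof.
case: n u i F => [|k] u i F; first by case: i.
move=> c0 FS /= [x0 [M [Fx0 freeM FM _]]] Fi.
(* The base point together with the differences. *)
pose A : 'M_k.+1 := col_mx x0 M.
have Mu : M *m u^T = 0.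
  apply/colP => a; rewrite mxE [RHS]mxE.
  have [[_ e1] [_ e2]] := (FS _ Fx0, FS _ (FM a)).
  move: e2; rewrite dotDr e1 => /(canRL (addKr _)); rewrite addNr => e3.
  transitivity (dot u (row a M)) => //.
  by apply: eq_bigr => l _; rewrite !mxE mulrC.
have : A \in unitmx.
  rewrite -row_free_unit; apply: inj_row_free => a.
  rewrite -[a](@hsubmxK _ 1 1 k) (@mul_row_col _ 1 1 k).
  set b := lsubmx _; set e := rsubmx _ => be.
  have b0 : b = 0.
    move: (congr1 (mulmx^~ u^T) be).
    rewrite mulmxDl -!mulmxA Mu mulmx0 addr0 mul0mx => /matrixP /(_ 0 0).
    rewrite !mxE big_ord1 -dot_mulmx; have [_ ->] := FS _ Fx0.
    move=> /eqP; rewrite mulf_eq0 (negPf c0) orbF => /eqP b0.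
    by apply/matrixP => r s; rewrite !ord1 b0 mxE.
  move: be; rewrite b0 mul0mx add0r => eM.
  have -> : e = 0 by apply: (row_free_inj freeM); rewrite mul0mx.
  by rewrite row_mx0.
move=> Au; have : A *m delta_mx i 0 = 0 :> 'cV_k.+1.
  rewrite -colE; apply/colP => r; rewrite mxE [RHS]mxE /A.
  case: (splitP (r : 'I_(1 + k))) => j rj.
    have -> : r = lshift k j by apply: val_inj.
    by rewrite (@col_mxEu _ 1) (ord1 j) Fi.
  have -> : r = rshift 1 j by apply: val_inj.
  rewrite (@col_mxEd _ 1); have /eqP := Fi _ (FM j).
  by rewrite !mxE Fi // add0r => /eqP.
move=> /(congr1 (mulmx (invmx A))); rewrite mulKmx // mulmx0.
by move=> /colP /(_ i) /eqP; rewrite !mxE !eqxx oner_eq0.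
Qed.

End SimplexDimension.

(** * Sums of parallel simplices *)

Section SimplexSum.
Context {R : realType} {n : nat}.
Implicit Types (u v x : 'rV[R]_n) (c : R).

Lemma sum_pos (p : nat) (c : 'I_p -> R) :
  (0 < p)%N -> (forall j, 0 < c j) -> 0 < \sum_j c j.
Proof.
move=> p0 c0; rewrite (bigD1 (Ordinal p0)) //= ltr_pwDl //.
by apply: sumr_ge0 => j _; rewrite ltW.
Qed.

(** A summand contained in the hyperplane [v i = 0] would make the vertex on the
    axis [i] of the sum unreachable: its decomposition has nonnegative terms,
    so they all lie on that axis, and the term in the bad summand is 0, which
    is not of level [c j]. *)
Lemma simplex_face_summand (p : nat) u (c : 'I_p -> R)
    (Deltas : 'I_p -> set 'rV[R]_n) :
  (forall i, 0 < u 0 i) -> (forall j, 0 < c j) ->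
  (forall j, diagram_face (simplex u (c j)) (Deltas j)) ->
  simplex u (\sum_j c j) `<=` mink_sum Deltas ->
  forall j, Deltas j = simplex u (c j).
Proof.
move=> u0 c0 face_j sub j.
case: (simplex_face _ _ _ u0 (c0 j) (face_j j)) => // -[i Di]; exfalso.
have C0 : 0 <= \sum_j c j by apply: sumr_ge0 => k _; rewrite ltW.
have [y [yD vy]] := sub _ (simplex_vertex u _ i (u0 i) C0).
have yS k : simplex u (c k) (y k) by apply: diagram_face_sub (yD k).
have : dot u (y j) = 0; last by rewrite (yS j).2; apply/eqP; rewrite gt_eqF.
apply: big1 => l _; have [->|li] := eqVneq l i.
  by rewrite (Di _ (yD j)) mulr0.
have /esym/eqP := congr1 (fun v : 'rV_n => v 0 l) vy.
rewrite summxE !mxE (negPf li) andbF mulr0 psumr_eq0; last first.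
  by move=> k _; apply: (yS k).1.
by move=> /allP /(_ j (mem_index_enum _)) /eqP ->; rewrite mulr0.
Qed.

Lemma simplex_compact u c : (forall i, 0 < u 0 i) -> compact (simplex u c).
Proof.
move=> u0.
pose box := [set v : 'rV[R]_n | forall i, `[0, c / u 0 i]%classic (v 0 i)].
apply: (@subclosed_compact _ _ box).
- have -> : simplex u c =
      (\bigcap_i [set v : 'rV[R]_n | 0 <= v 0 i]) `&` [set v | dot u v = c].
    by apply/seteqP; split=> v [v0 vc]; split=> // i; [move=> _|]; apply: v0.
  apply: closedI.
    apply: closed_bigI => i _.
    apply: (@preimage_closed _ _ (fun v => v 0 i) [set r | 0 <= r]).
      by move=> v _; exact: coord_continuous.
    exact: closed_ge.
  apply: (@preimage_closed _ _ (dot u) [set c]); last exact: closed_eq.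
  move=> v _; rewrite /dot /continuous_at.
  apply: (@cvg_big _ _ _ _ _ add_continuous _ (nbhs v)) => i _.
  exact: (continuous_comp (@coord_continuous _ _ _ 0 i v)
    (@mulrl_continuous _ (u 0 i) _)).
- apply: (@rV_compact _ _ (fun i => `[0, c / u 0 i]%classic)) => i.
  exact: segment_compact.
- move=> v [v0 vc] i; rewrite /= in_itv /= v0 /=.
  rewrite ler_pdivlMr // mulrC -vc /dot (bigD1 i) //= lerDl.
  by apply: sumr_ge0 => k _; rewrite mulr_ge0 // ltW.
Qed.

(** The polyhedron [Q] to consider consists of vectors of the orthant with
    [C <= dot u v], and its points of level [C] form the compact face exposed
    by [u]. Conversely, a direction [t] exposing a compact face has positive
    coordinates, since otherwise the face would contain a ray; and then scaling
    a point of level above [C] down to level [C] would decrease [dot t]. *)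
Lemma diagram_sum_simplex (p : nat) u (c : 'I_p -> R) :
  (0 < n)%N -> (0 < p)%N ->
  (forall i, 0 < u 0 i) -> (forall j, 0 < c j) ->
  diagram_sum (fun j => simplex u (c j)) = simplex u (\sum_j c j).
Proof.
move=> n0 p0 u0 c0; set C := \sum_j c j.
have C0 : 0 < C by exact: sum_pos.
rewrite /diagram_sum; set Q := mink_sum _.
have SQ : simplex u C `<=` Q.
  move=> v [v0 vC]; exists (fun j => (c j / C) *: v); split.
    move=> j; exists ((c j / C) *: v).
      split; last by rewrite dotZr vC divfK // gt_eqF.
      by move=> i; rewrite mxE mulr_ge0 // divr_ge0 // ltW.
    by exists 0; rewrite ?addr0 // => i; rewrite mxE.
  by rewrite -scaler_suml -mulr_suml -/C divff ?scale1r // gt_eqF.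
have Qge v : Q v -> C <= dot u v.
  move=> [y [yD ->]]; rewrite dot_sumr; apply: ler_sum => j _.
  have [x [_ <-] [z z0 <-]] := yD j.
  by rewrite dotDr lerDl dot_ge0 // => i; rewrite ltW.
have Qorth v : Q v -> orthant v.
  move=> [y [yD ->]] i; rewrite summxE; apply: sumr_ge0 => j _.
  have [x [x0 _] [z z0 <-]] := yD j.
  by rewrite mxE addr_ge0.
have QD v z : Q v -> orthant z -> Q (v + z).
  move=> [y [yD ->]] z0.
  exists (fun j => y j + if j == Ordinal p0 then z else 0); split.
    move=> j; have [x xS [t t0 <-]] := yD j.
    exists x => //; exists (t + if j == Ordinal p0 then z else 0).
      by move=> i; rewrite mxE addr_ge0 //; case: eqP => // _; rewrite mxE.
    by rewrite addrA.
  by rewrite big_split /= -big_mkcond /= big_pred1_eq.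
have Sarg : simplex u C = argmin u Q.
  apply/seteqP; split=> v.
    by move=> Sv; split; [exact: SQ | move=> v' /Qge; rewrite (Sv.2)].
  move=> [Qv vmin]; split; first exact: Qorth.
  apply/le_anti; rewrite Qge // andbT.
  have Sx := simplex_vertex u C (Ordinal n0) (u0 _) (ltW C0).
  by rewrite -[leRHS](Sx.2); apply/vmin/SQ.
apply/seteqP; split=> v; last first.
  move=> Sv; exists (simplex u C) => //; split; last exact: simplex_compact.
  by split; [exists v | exists u].
(* From here on: a compact face, exposed by some direction t, lies in the
   simplex. *)
move=> [_ [[_ [t ->]] Fc] [Qv vmin]].
have delta_ge0 (a : R) i : 0 <= a -> orthant (a *: delta_mx 0 i : 'rV[R]_n).
  by move=> a0 k; rewrite !mxE mulr_ge0.
have t0 i : 0 < t 0 i.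
  rewrite lt_neqAle; apply/andP; split; last first.
    have := vmin _ (QD v _ Qv (delta_ge0 1 i ler01)).
    by rewrite dotDr dotZr dot_delta mul1r lerDl.
  apply/eqP => ti0.
  have Farg a : 0 <= a -> argmin t Q (v + a *: delta_mx 0 i).
    move=> a0; split; first by apply: QD => //; apply: delta_ge0.
    by move=> v' Qv'; rewrite dotDr dotZr dot_delta -ti0 mulr0 addr0 vmin.
  have /compact_bounded [M [_ MF]] := continuous_compact
    (continuous_subspaceT (@coord_continuous _ _ _ 0 i)) Fc.
  have M1 : M < M + 1 by rewrite ltrDl.
  (* A point of the ray whose coordinate i exceeds the bound M + 1. *)
  pose a := `|v 0 i| + (`|M| + 2).
  have a0 : 0 <= a by rewrite !addr_ge0.
  have := MF _ M1 (v 0 i + a); rewrite /= leNgt => /(_ _) /negP; apply.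
    by exists (v + a *: delta_mx 0 i); [exact: Farg | rewrite !mxE !eqxx mulr1].
  have va : `|M| + 2 <= v 0 i + a.
    rewrite /a (addrA (v 0 i)) lerDr -lerBlDl sub0r.
    by rewrite -normrN ler_norm.
  apply: lt_le_trans (le_trans va (ler_norm _)).
  by rewrite (le_lt_trans (lerD (ler_norm M) (lexx 1))) // ltrD2l ltr1n.
have vS : 0 < dot u v by apply: lt_le_trans (Qge _ Qv).
split; first exact: Qorth.
apply/le_anti; rewrite Qge // andbT.
have Qv' : Q ((C / dot u v) *: v).
  apply: SQ; split; last by rewrite dotZr divfK // gt_eqF.
  by move=> i; rewrite mxE mulr_ge0 ?divr_ge0 ?(ltW vS) ?(ltW C0) // Qorth.
have tv : 0 < dot t v.
  rewrite lt_neqAle dot_ge0 ?andbT; [|by move=> i; rewrite ltW|exact: Qorth].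
  apply/eqP => /esym /eqP; rewrite psumr_eq0; last first.
    by move=> i _; rewrite mulr_ge0 ?(ltW (t0 i)) // Qorth.
  move=> /allP v0; have : dot u v = 0; last by move=> e; rewrite e ltxx in vS.
  apply: big1 => i _; have := v0 i (mem_index_enum _).
  by rewrite /= mulf_eq0 gt_eqF //= => /eqP ->; rewrite mulr0.
have := vmin _ Qv'; rewrite dotZr -[leLHS]mul1r ler_pM2r //.
by rewrite ler_pdivlMr // mul1r.
Qed.

End SimplexSum.

(** * Semi-weighted homogeneous maps *)

Section SemiWeightedHomogeneous.
Context {R : realType} {n : nat}.
Implicit Types (u v x : 'rV[R]_n) (w : 'rV[rat]_n).

Lemma toR_gt0 w i : posw w -> 0 < toR R w 0 i.
Proof. by move=> w0; rewrite mxE ltr0q. Qed.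

Lemma simplex_C_face_diagram w (c : rat) : posw w -> 0 < c ->
  C_face_diagram (simplex (toR R w) (ratr c)).
Proof.
move=> w0 c0; exists [set c^-1 *: w]; last by rewrite simplex_diagram.
split; [exact: finite_set1 | by exists (c^-1 *: w) |].
by move=> _ -> i; rewrite mxE mulr_gt0 ?invr_gt0.
Qed.

Lemma simplex_facet_weights w (c : R) : (0 < n)%N -> posw w -> 0 < c ->
  facet_weights (simplex (toR R w) c) [set w].
Proof.
move=> n0 w0 c0; have u0 i := toR_gt0 w i w0.
split=> [_ -> //|_ ->|F DF dimF].
  by rewrite argmin_simplex; apply: simplex_has_dim.
exists w; split=> [|_ [-> //]]; split=> //; rewrite argmin_simplex.
case: (simplex_face _ _ _ u0 c0 DF) => [-> //|[i Fi]]; exfalso.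
apply: (simplex_facet_coord _ _ i _ _ (diagram_face_sub _ _ DF) dimF Fi).
by rewrite gt_eqF.
Qed.

Lemma diagram_deg_simplex w (c : R) : (0 < n)%N -> posw w -> 0 < c ->
  diagram_deg w (simplex (toR R w) c) = c.
Proof.
move=> n0 w0 c0; rewrite /diagram_deg.
have Sv := simplex_vertex (toR R w) c (Ordinal n0) (toR_gt0 w _ w0) (ltW c0).
suff -> : [set dot (toR R w) v | v in simplex (toR R w) c] = [set c].
  exact: inf1.
apply/seteqP; split=> [_ [v [_ vc] <-] //|_ ->].
by exists (vertex (toR R w) c (Ordinal n0)) => //; apply: Sv.2.
Qed.

Lemma part_simplex (p : nat) (f : 'I_p -> mpoly n R) w (d : 'rV[rat]_p) j :
  WH w d (initial_map w f) ->
  part (f j) (simplex (toR R w) (ratr (d 0 j))) = initial w (f j).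
Proof.
move=> hom; have [f0|f0] := pselect (f j = 0).
  by rewrite /initial /part f0 msupp0 !big_nil.
apply: eq_part => m mf /=; rewrite (WH_wdeg j hom f0).
split=> [[_ ->] //|[me]]; split=> // i.
by rewrite mxE.
Qed.

Lemma WH_diagrams_below (p : nat) (f : 'I_p -> mpoly n R) w (d : 'rV[rat]_p) :
  (0 < n)%N -> WH w d (initial_map w f) ->
  diagrams_below f (fun j => simplex (toR R w) (ratr (d 0 j))).
Proof.
move=> n0 hom; have [_ w0 d0 _] := hom.
split=> [j|]; first exact: simplex_C_face_diagram.
exists (fun=> [set w]) => j; split.
  by apply: simplex_facet_weights => //; rewrite ltr0q.
move=> _ ->; rewrite diagram_deg_simplex ?ltr0q //.
have [f0|f0] := pselect (f j = 0); last by rewrite (WH_wdeg j hom f0).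
by rewrite /wdeg f0 msupp0 big_nil leey.
Qed.

(** The predicate [Z] is arbitrary in order to treat the two kinds of
    singularities, critical zeros and critical points, at once. *)
Lemma WH_face_condition (p : nat) (f : 'I_p -> mpoly n R) w (d : 'rV[rat]_p) Z :
  (0 < n)%N -> (0 < p)%N -> WH w d (initial_map w f) ->
  Z (initial_map w f) `<=` [set 0] ->
  face_condition Z f (fun j => simplex (toR R w) (ratr (d 0 j))).
Proof.
move=> n0 p0 hom Z0; have [_ w0 d0 _] := hom.
have u0 i := toR_gt0 w i w0.
have c0 j : 0 < ratr (d 0 j) :> R by rewrite ltr0q.
have C0 : 0 < \sum_j ratr (d 0 j) :> R by exact: sum_pos.
move=> Delta Deltas; rewrite diagram_sum_simplex // => DD innerD face_j eqD.
move=> I /finset.set0Pn [i iI] _.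
have {innerD DD} DeltaE := simplex_inner_face _ _ _ u0 C0 DD innerD.
have DeltasE j : Deltas j = simplex (toR R w) (ratr (d 0 j)).
  apply: (simplex_face_summand _ _ (fun j => ratr (d 0 j)) Deltas) => //.
  by rewrite -DeltaE eqD.
have -> : (fun j => part (f j) (Deltas j)) = initial_map w f.
  by apply/funext => j; rewrite DeltasE (part_simplex _ _ _ _ _ hom).
by apply/seteqP; split=> // x [/Z0 -> [_ /(_ i iI)]]; rewrite mxE eqxx.
Qed.

End SemiWeightedHomogeneous.

Theorem proposition2p9 (R : realType) (n p : nat) (f : 'I_p -> mpoly n R)
    (w : 'rV[rat]_n) (d : 'rV[rat]_p) :
  polynomial_map f -> SWH w d f ->
  IKND f /\ (crit (initial_map w f) = [set 0] -> SIKND f).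
Proof.
move=> _ [hom crit0 _]; have [pn _ _ _] := hom.
(* The Jacobian at the critical point 0 has rank less than p, so p > 0. *)
have p0 : (0 < p)%N.
  have [+ _] : (crit (initial_map w f) `&` zeros (initial_map w f)) 0.
    by rewrite crit0.
  exact: leq_ltn_trans.
have n0 := leq_trans p0 pn.
have below := WH_diagrams_below _ _ _ _ n0 hom.
have face Z := WH_face_condition _ _ _ _ Z n0 p0 hom.
have condVS : face_condition (fun h => crit h `&` zeros h) f
    (fun j => simplex (toR R w) (ratr (d 0 j))).
  by apply: face; rewrite crit0.
split; first by exists (fun j => simplex (toR R w) (ratr (d 0 j))).
move=> crit_w; exists (fun j => simplex (toR R w) (ratr (d 0 j))); split=> //.
by apply: face; rewrite crit_w.
Qed.
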